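(* Let $\kappa>0$, let $P_T=\{x_j\}_{j=1}^{N_T}$ and $P_S=\{y_k\}_{k=1}^{N_S}$ be finite sets of points in $\mathbb{R}^3$ contained in axis-parallel boxes $T$ and $S$, respectively, let $N=\max\{N_T,N_S\}$, and let $\mathcal{T}_T$, $\mathcal{T}_S$ be the corresponding uniform box cluster trees with parameter $n_{\max}$. Let $p_{\max}$ be the maximum of their depths and $q_0=\max\{q_0(\mathcal{T}_T),q_0(\mathcal{T}_S)\}$ the larger of the diameters of the root boxes. Let $\mathcal{T}_{T\times S}$ be the block tree with parameter $\eta_2>0$, let $\ell_{\mathrm{hf}}\ge-1$ be the chosen largest high frequency level and $m$ the fixed interpolation degree. Assume that there are constants $c_{\max},c_{\mathrm{un}},c_{\mathrm{ad}},c_{\mathrm{geo}}\in\mathbb{R}_+$, $c_{\mathrm{hf}}\in\mathbb{N}_0$, $c_{\mathrm{in}}\in\mathbb{N}$ and fixed parameters $c_{\mathrm{m}},c_{\mathrm{nf}}$ (entering the definition of $\mathcal{L}_T^-,\mathcal{L}_S^-$) such that $$n_{\max}\le c_{\max}(m+1)^3,\qquad q_0\le c_{\mathrm{un}}\min\{q_0(\mathcal{T}_T),q_0(\mathcal{T}_S)\},\qquad p_{\max}\le\log_8(N)+c_{\mathrm{ad}},$$ $$\kappa q_0\le c_{\mathrm{geo}}\sqrt[3]{N},\qquad \ell_{\mathrm{hf}}+1\le p_{\max}+c_{\mathrm{hf}},\qquad \#\mathcal{L}_T^-\le c_{\mathrm{in}},\quad\#\mathcal{L}_S^-\le c_{\mathrm{in}}.$$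 Then the complexity of the fast directional matrix-vector multiplication $g\approx Av$ is $\mathcal{O}(N\log(N))$. If the assumption $\kappa q_0\le c_{\mathrm{geo}}\sqrt[3]{N}$ is replaced by $\kappa q_0\le c\sqrt[3]{N/\log(N)}$ for a constant $c$, the complexity is reduced to $\mathcal{O}(N)$.
   Context: **Matrix.** $A\in\mathbb{C}^{N_T\times N_S}$ has entries $A[j,k]=\exp(i\kappa|x_j-y_k|)/(4\pi|x_j-y_k|)$. **Uniform box cluster tree.** Given a finite set of points in an axis-parallel half-open box $T=(a_1,b_1]\times(a_2,b_2]\times(a_3,b_3]$ and $n_{\max}\in\mathbb{N}$, the tree $\mathcal{T}_T$ has root $T$ (level 0). Recursively, a box containing more than $n_{\max}$ of the points is subdivided at its center into 8 congruent half-open boxes, and those of the 8 boxes containing at least one point become its children. A box with at most $n_{\max}$ points is a leaf. $\mathcal{L}_T$ is the set of leaves, $\mathcal{T}_T^{(\ell)}$ the set of boxes at level $\ell$, $p(\mathcal{T}_T)$ the depth (maximal level), $q_\ell(\mathcal{T}_T)$ the common diameter of the boxes at level $\ell$, $\hat t=\{j:x_j\in t\}$, and $m_t$ the midpoint of $t$. Analogously for $S$. **Block tree.** Let $\operatorname{diam}(t)=\sup_{x_1,x_2\in t}|x_1-x_2|$, $\operatorname{dist}(t,s)=\inf_{x\in t,y\in s}|x-y|$. Consider for a pair $(t,s)$ the criteria (A1) $\max\{\operatorname{diam}(t),\operatorname{diam}(s)\}\le\eta_2\operatorname{dist}(t,s)$, (A3) $\kappa\max\{\operatorname{diam}(t),\operatorname{diam}(s)\}^2\le\eta_2\operatorname{dist}(t,s)$.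 The block tree $\mathcal{T}_{T\times S}$ has root $(T,S)$. A block $(t,s)$ is a leaf of it if $t\in\mathcal{L}_T$ or $s\in\mathcal{L}_S$ or if (A1) and (A3) both hold. Otherwise its children are all $(t',s')$ with $t'$ a child of $t$ and $s'$ a child of $s$. The leaves are split into $\mathcal{L}_{T\times S}^+$ (those satisfying (A1) and (A3)) and $\mathcal{L}_{T\times S}^-$ (the others). **Outlying leaves.** $\mathcal{L}_S^+=\{s\in\mathcal{L}_S:\#\{t:(t,s)\in\mathcal{L}_{T\times S}^-\}\le c_{\mathrm{nf}}\text{ and }\#\hat t\le c_{\mathrm{m}}n_{\max}\text{ for all }(t,s)\in\mathcal{L}_{T\times S}^-\}$, $\mathcal{L}_S^-=\mathcal{L}_S\setminus\mathcal{L}_S^+$. $\mathcal{L}_T^\pm$ are defined analogously with roles exchanged. **Directions.** For $\ell>\ell_{\mathrm{hf}}$ set $D^{(\ell)}=\{0\}$. For $0\le\ell\le\ell_{\mathrm{hf}}$ the surface of $[-1,1]^3$ is divided into squares: $E^{(\ell_{\mathrm{hf}})}_1,\dots,E^{(\ell_{\mathrm{hf}})}_6$ are its six faces, and $E^{(\ell)}_{4(j-1)+1},\dots,E^{(\ell)}_{4j}$ are the four congruent squares obtained by uniformly subdividing $E_j^{(\ell+1)}$. $c_j^{(\ell)}$ is the normalized midpoint of $E_j^{(\ell)}$, and $D^{(\ell)}=\{c_j^{(\ell)}:j=1,\dots,6\cdot4^{\ell_{\mathrm{hf}}-\ell}\}$. Define $\operatorname{dir}_{(\ell)}(v)=0$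 if $\ell>\ell_{\mathrm{hf}}$ or $v=0$, and otherwise $\operatorname{dir}_{(\ell)}(v)=c^{(\ell)}_{j(v)}$ with $j(v)=\min\{j:v/\max_i|v_i|\in E_j^{(\ell)}\}$. Put $c_{(\ell)}(t,s)=\operatorname{dir}_{(\ell)}((m_t-m_s)/|m_t-m_s|)$. For $t\in\mathcal{T}_T^{(\ell)}$ let $D(t)=\{c\in D^{(\ell)}:\exists s\in\mathcal{T}_S^{(\ell)}\text{ with }(t,s)\in\mathcal{L}_{T\times S}^+,\ c=c_{(\ell)}(t,s)\}$. Let $\hat D(T)=\emptyset$ for the root, and for $\ell>0$ let $\hat D(t)=\{\hat c\in D^{(\ell)}:\exists c\in D(t')\cup\hat D(t')\text{ with }\hat c=\operatorname{dir}_{(\ell)}(c),\ t'=\operatorname{parent}(t)\}$. Analogously for $s\in\mathcal{T}_S$. **Matrices.** With tensor Chebyshev nodes $\xi_{t,\nu}$ of order $m+1$ on $t$ ($\nu\in\{1,\dots,m+1\}^3$, suitably ordered) and the corresponding tensor Lagrange polynomials $L_{t,\nu}$: - directional interpolation matrices $L_{t,c}\in\mathbb{C}^{\hat t\times(m+1)^3}$ with entries $L_{t,\nu}(x_j)\exp(i\kappa\langle x_j,c\rangle)$ (for $s\in\mathcal{T}_S$, with $y_k$ in place of $x_j$); - transfer matrices $E_{t',c}\in\mathbb{C}^{(m+1)^3\times(m+1)^3}$ for a child $t'$ of $t\in\mathcal{T}_T^{(\ell)}$, with entries $\exp(i\kappa\langle\xi_{t',\mu},c-c'\rangle)L_{t,\nu}(\xi_{t',\mu})$,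 $c'=\operatorname{dir}_{(\ell+1)}(c)$ (analogously for $s\in\mathcal{T}_S$); - coupling matrices $A_{c,t\times s}\in\mathbb{C}^{(m+1)^3\times(m+1)^3}$ with entries $\exp(i\kappa(|x-y|-\langle x-y,c\rangle))/(4\pi|x-y|)$ at $x=\xi_{t,\alpha}$, $y=\xi_{s,\beta}$. **Algorithm (fast directional matrix-vector multiplication).** Given the trees, the block tree and the direction sets, and starting from $g=0$: 1. For all leaves $s\in\mathcal{L}_S$ and $c\in D(s)\cup\hat D(s)$: $\tilde v_{s,c}=L_{s,c}^*v|_{\hat s}$. 2. For levels $\ell=p(\mathcal{T}_S)-1,\dots,0$, all non-leaf $s\in\mathcal{T}_S^{(\ell)}$ and $c\in D(s)\cup\hat D(s)$: $\tilde v_{s,c}=\sum_{s'\in\operatorname{child}(s)}E_{s',c}^*\tilde v_{s',c'}$, $c'=\operatorname{dir}_{(\ell+1)}(c)$. 3. Initialize all $\tilde g_{t,c}=0$ ($c\in D(t)\cup\hat D(t)$). For all $(t,s)\in\mathcal{L}_{T\times S}^+$ at level $\ell$, with $c=c_{(\ell)}(t,s)$: $\tilde g_{t,c}\mathrel{+}=A_{c,t\times s}\tilde v_{s,c}$. 4. For $\ell=0,\dots,p(\mathcal{T}_T)-1$, all non-leaf $t\in\mathcal{T}_T^{(\ell)}$, $c\in D(t)\cup\hat D(t)$ and $t'\in\operatorname{child}(t)$: $\tilde g_{t',c'}\mathrel{+}=E_{t',c}\tilde g_{t,c}$, $c'=\operatorname{dir}_{(\ell+1)}(c)$. 5. For all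 leaves $t\in\mathcal{L}_T$ and $c\in D(t)\cup\hat D(t)$: $g|_{\hat t}\mathrel{+}=L_{t,c}\tilde g_{t,c}$. 6. For all $(t,s)\in\mathcal{L}_{T\times S}^-$: $g|_{\hat t}\mathrel{+}=A|_{\hat t\times\hat s}v|_{\hat s}$. **Cost model.** Every matrix above is applied to a vector exactly once, and each entry is computable in $\mathcal{O}(1)$ operations. The (runtime and storage) complexity of the algorithm is measured by the total number of entries of all matrices $L_{t,c},L_{s,c},E_{t',c},E_{s',c},A_{c,t\times s},A|_{\hat t\times\hat s}$ applied in steps 1–6. In the $\mathcal{O}$-statements, $m$, $\eta_2$ and the constants in the assumptions are regarded as fixed.
   Formalization: The constants in the O-bounds also depend on an arbitrary fixed bound for the side-length ratios of the boxes T and S; for arbitrarily elongated boxes the claim with constants depending only on the listed parameters is false. *)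

(* Defs.v *)
From HB Require Import structures.
From mathcomp Require Import all_boot all_order all_algebra finmap.
From mathcomp Require Import all_classical all_reals all_analysis.
From mathcomp Require Import complex ring lra.

Set Implicit Arguments.
Unset Strict Implicit.
Unset Printing Implicit Defensive.

Import Order.TTheory GRing.Theory Num.Theory.

Local Open Scope ring_scope.

Section Geometry.
Variable R : realType.

Definition point := 'rV[R]_3.

Definition dotp (x y : point) : R := \sum_(i < 3) x ord0 i * y ord0 i.

(* The library norm on row vectors is the maximum norm, hence this one. *)
Definition enorm (x : point) : R := Num.sqrt (dotp x x).

Definition maxnorm (x : point) : R := \big[Num.max/0]_(i < 3) `|x ord0 i|.

(* A box is the pair of its lower corner a and upper corner b. Half-open
   boxes (a1,b1]x(a2,b2]x(a3,b3] carry the clusters; closed, flat ones are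
   used for the squares on the surface of the cube [-1,1]^3. *)
Definition box := (point * point)%type.

Definition in_box (t : box) (x : point) : bool :=
  [forall i, (t.1 ord0 i < x ord0 i) && (x ord0 i <= t.2 ord0 i)].

Definition in_cbox (t : box) (x : point) : bool :=
  [forall i, (t.1 ord0 i <= x ord0 i) && (x ord0 i <= t.2 ord0 i)].

Definition box_set (t : box) : set point := [set x | in_box t x]%classic.

Definition side (t : box) (i : 'I_3) : R := t.2 ord0 i - t.1 ord0 i.

(* The ratio of any two side lengths of t is at most c. *)
Definition aspect_le (c : R) (t : box) : Prop :=
  forall i j, side t i <= c * side t j.

Definition midpoint (t : box) : point := 2^-1 *: (t.1 + t.2).

Definition diam (t : box) : R :=
  sup [set enorm (x - y) | x in box_set t & y in box_set t]%classic.

Definition dist (t s : box) : R :=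
  inf [set enorm (x - y) | x in box_set t & y in box_set s]%classic.

Definition subbox (t : box) (o : {ffun 'I_3 -> bool}) : box :=
  (\row_i (if o i then midpoint t ord0 i else t.1 ord0 i),
   \row_i (if o i then t.2 ord0 i else midpoint t ord0 i)).

(* Eight boxes if t is nondegenerate, four squares if t is a square parallel
   to two of the axes. *)
Definition subboxes (t : box) : {fset box} :=
  [fset subbox t o | o : {ffun 'I_3 -> bool}]%fset.

End Geometry.

Section ClusterTree.
Variable R : realType.

Record cloud := Cloud {
  npts : nat;
  pts : 'I_npts -> point R;
  root_box : box R;
  pts_inj : injective pts;
  root_box_gt0 : forall i, 0 < side root_box i;
  pts_root_box : forall j, in_box root_box (pts j) }.

Arguments pts : clear implicits.
Arguments root_box : clear implicits.

Variables (X : cloud) (nmax : nat).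

Definition indices (t : box R) : {set 'I_(npts X)} :=
  [set j | in_box t (pts X j)].

Definition is_leaf (t : box R) : bool := (#|indices t| <= nmax)%N.

Definition child (t : box R) : {fset box R} :=
  if is_leaf t then fset0
  else [fset t' in subboxes t | indices t' != finset.set0]%fset.

Fixpoint level (l : nat) : {fset box R} :=
  if l is k.+1 then (\bigcup_(t <- level k) child t)%fset
  else [fset root_box X]%fset.

Definition is_depth (p : nat) : Prop :=
  level p <> fset0 /\ level p.+1 = fset0.

(* The default value is never used if nmax > 0: see depthP below. *)
Definition depth : nat := xget 0%N is_depth.

Lemma side_subbox (t : box R) o i : side (subbox t o) i = side t i / 2.
Proof. by rewrite /side /= /midpoint !mxE; case: (o i); field. Qed.

Lemma side_level l t i : t \in level l -> side t i = side (root_box X) i / 2 ^+ l.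
Proof.
elim: l t => [|l IHl] t /=; first by move=> /fset1P ->; rewrite divr1.
move=> /bigfcupP [u /andP [ul _]]; rewrite /child; case: ifP => _ //.
rewrite !inE => /andP [] /imfsetP [] o _ -> _.
by rewrite side_subbox (IHl u ul) exprSr invfM mulrA.
Qed.

Lemma level_empty : (0 < nmax)%N -> exists p, level p.+1 == fset0.
Proof.
move=> nmax_gt0.
pose gap (j k : 'I_(npts X)) i := `|pts X j ord0 i - pts X k ord0 i|.
pose F (q : 'I_(npts X) * 'I_(npts X) * 'I_3) :=
  (Num.truncn (side (root_box X) q.2 / gap q.1.1 q.1.2 q.2)).+1.
pose L := \max_q F q.
exists L; rewrite -fsubset0; apply/fsubsetP => t /bigfcupP[u /andP[uL _]].
rewrite /child; case: ifPn => // /negP[].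
rewrite /is_leaf (leq_trans _ nmax_gt0)//; apply/card_le1_eqP => j k.
rewrite !inE => /forallP uj /forallP uk; apply: contrapT => /eqP jk.
have [i ni] : exists i, pts X j ord0 i != pts X k ord0 i.
  apply/not_existsP => h; move/eqP: jk; apply.
  apply: (@pts_inj X); apply/rowP => i; apply/eqP.
  by rewrite eq_sym; apply: contrapT => hi; apply: (h i); apply/negP.
have gap_gt0 : 0 < gap j k i by rewrite normr_gt0 subr_eq0.
have : gap j k i < side u i.
  have /andP [? ?] := uj i; have /andP [? ?] := uk i.
  by rewrite /gap /side ltr_norml; apply/andP; split; lra.
rewrite (side_level i uL) ltr_pdivlMr ?exprn_gt0// => h.
have : side (root_box X) i / gap j k i < 2 ^+ L.
  apply: (lt_le_trans (truncnS_gt _)).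
  rewrite -natrX ler_nat; apply: (leq_trans (@leq_bigmax _ F (j, k, i))).
  by rewrite -/L ltnW// ltn_expl.
by rewrite ltr_pdivrMr// mulrC => h'; have := lt_trans h h'; rewrite ltxx.
Qed.

Lemma depthP : (0 < nmax)%N -> is_depth depth.
Proof.
move=> /level_empty ex; apply: xgetPex; exists (ex_minn ex).
case: ex_minnP => -[|p] /eqP p0 pmin; split => //.
  by move/fsetP/(_ (root_box X)); rewrite !inE eqxx.
by move/eqP/pmin; rewrite ltnn.
Qed.

Definition boxes : {fset box R} :=
  (\bigcup_(l <- iota 0 depth.+1) level l)%fset.

Definition leaves_at (l : nat) : {fset box R} :=
  [fset t in level l | is_leaf t]%fset.

Definition inner_at (l : nat) : {fset box R} :=
  [fset t in level l | ~~ is_leaf t]%fset.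

Definition leaves : {fset box R} := [fset t in boxes | is_leaf t]%fset.

End ClusterTree.

Arguments pts {R} c j.
Arguments root_box {R} c.

Section Directions.
Variable R : realType.

Definition face (i : 'I_3) (b : bool) : box R :=
  (\row_k (if (k == i) && b then 1 else -1),
   \row_k (if (k == i) && ~~ b then -1 else 1)).

Definition faces : {fset box R} :=
  [fset face i b | i : 'I_3, b : bool]%fset.

Variable lhf : int.

(* E l j is the square E^(l)_(j+1). The numbering of the six faces and of the
   four parts of a square is arbitrary. *)
Definition is_square_numbering (E : nat -> nat -> box R) : Prop :=
  (forall l : nat, l%:Z = lhf ->
     [fset E l (val j) | j : 'I_6]%fset = faces) /\
  (forall l j : nat, l.+1%:Z <= lhf -> (j < 6 * 4 ^ `|lhf - l.+1%:Z|)%N ->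
     [fset E l (4 * j + val i)%N | i : 'I_4]%fset = subboxes (E l.+1 j)).

Variable E : nat -> nat -> box R.

Definition ndir (l : nat) : nat := (6 * 4 ^ `|lhf - l%:Z|)%N.

Definition center (l j : nat) : point R :=
  (enorm (midpoint (E l j)))^-1 *: midpoint (E l j).

Definition dirset (l : nat) : {fset point R} :=
  if lhf < l%:Z then [fset 0]%fset
  else [fset center l (val j) | j : 'I_(ndir l)]%fset.

Definition dir (l : nat) (v : point R) : point R :=
  if (lhf < l%:Z) || (v == 0) then 0
  else center l (find (fun j => in_cbox (E l j) ((maxnorm v)^-1 *: v))
                      (iota 0 (ndir l))).

Definition dir_pair (l : nat) (t s : box R) : point R :=
  dir l ((enorm (midpoint t - midpoint s))^-1 *: (midpoint t - midpoint s)).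

(* The sets \hat D, for the tree of X and the sets D l t of its boxes t. *)
Fixpoint inherited (X : cloud R) (nmax : nat)
    (D : nat -> box R -> {fset point R}) (l : nat) (t : box R) :
    {fset point R} :=
  if l is k.+1 then
    [fset c in dirset k.+1 |
       has (fun t' => (t \in child X nmax t') &&
              has (fun c0 => c == dir k.+1 c0)
                  (D k t' `|` inherited X nmax D k t'))
           (level X nmax k)]%fset
  else fset0.

End Directions.

Record problem (R : realType) := Problem {
  kappa : R;
  trg : cloud R;
  src : cloud R;
  nmax : nat;
  lhf : int;
  squares : nat -> nat -> box R;
  kappa_gt0 : 0 < kappa;
  nmax_gt0 : (0 < nmax)%N;
  lhf_geN1 : -1 <= lhf;
  squares_numbering : is_square_numbering lhf squares }.

Section Problem.
Variables (R : realType) (P : problem R).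

Definition npoints : nat := maxn (npts (trg P)) (npts (src P)).

Definition depth_trg : nat := depth (trg P) (nmax P).
Definition depth_src : nat := depth (src P) (nmax P).
Definition pmax : nat := maxn depth_trg depth_src.

Definition q0_trg : R := diam (root_box (trg P)).
Definition q0_src : R := diam (root_box (src P)).
Definition q0 : R := Num.max q0_trg q0_src.

End Problem.

Section BlockTree.
Variables (R : realType) (eta2 : R) (P : problem R).

Notation X := (trg P).
Notation Y := (src P).
Notation n := (nmax P).

Definition critA1 (t s : box R) : bool :=
  Num.max (diam t) (diam s) <= eta2 * dist t s.

Definition critA3 (t s : box R) : bool :=
  kappa P * Num.max (diam t) (diam s) ^+ 2 <= eta2 * dist t s.

Definition adm (b : box R * box R) : bool := critA1 b.1 b.2 && critA3 b.1 b.2.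

Definition block_leaf (b : box R * box R) : bool :=
  [|| is_leaf X n b.1, is_leaf Y n b.2 | adm b].

Definition block_child (b : box R * box R) : {fset box R * box R} :=
  if block_leaf b then fset0 else (child X n b.1 `*` child Y n b.2)%fset.

Fixpoint blocks (l : nat) : {fset box R * box R} :=
  if l is k.+1 then (\bigcup_(b <- blocks k) block_child b)%fset
  else [fset (root_box X, root_box Y)]%fset.

Definition farfield_at (l : nat) : {fset box R * box R} :=
  [fset b in blocks l | block_leaf b & adm b]%fset.

Definition nearfield_at (l : nat) : {fset box R * box R} :=
  [fset b in blocks l | block_leaf b & ~~ adm b]%fset.

(* Both components of a block of level l have level l in their trees. *)
Definition nearfield : {fset box R * box R} :=
  (\bigcup_(l <- iota 0 (pmax P).+1) nearfield_at l)%fset.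

Definition nonoutlying_trg (c_m c_nf : R) (t : box R) : bool :=
  ((#|` [fset b in nearfield | b.1 == t]%fset|)%:R <= c_nf) &&
  all (fun b : box R * box R =>
         (b.1 == t) ==> (#|indices Y b.2|%:R <= c_m * n%:R)) nearfield.

Definition nonoutlying_src (c_m c_nf : R) (s : box R) : bool :=
  ((#|` [fset b in nearfield | b.2 == s]%fset|)%:R <= c_nf) &&
  all (fun b : box R * box R =>
         (b.2 == s) ==> (#|indices X b.1|%:R <= c_m * n%:R)) nearfield.

(* The sets L_T^- and L_S^-. *)
Definition outlying_trg (c_m c_nf : R) : {fset box R} :=
  [fset t in leaves X n | ~~ nonoutlying_trg c_m c_nf t]%fset.

Definition outlying_src (c_m c_nf : R) : {fset box R} :=
  [fset s in leaves Y n | ~~ nonoutlying_src c_m c_nf s]%fset.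

Definition dir_at (l : nat) : point R -> point R := dir (lhf P) (squares P) l.

Definition dir_block (l : nat) (t s : box R) : point R :=
  dir_pair (lhf P) (squares P) l t s.

Definition D_trg (l : nat) (t : box R) : {fset point R} :=
  [fset c in dirset (lhf P) (squares P) l |
     has (fun s => ((t, s) \in farfield_at l) && (c == dir_block l t s))
         (level Y n l)]%fset.

Definition D_src (l : nat) (s : box R) : {fset point R} :=
  [fset c in dirset (lhf P) (squares P) l |
     has (fun t => ((t, s) \in farfield_at l) && (c == dir_block l t s))
         (level X n l)]%fset.

(* The unions of D and \hat D. *)
Definition dirs_trg (l : nat) (t : box R) : {fset point R} :=
  (D_trg l t `|` inherited (lhf P) (squares P) X n D_trg l t)%fset.

Definition dirs_src (l : nat) (s : box R) : {fset point R} :=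
  (D_src l s `|` inherited (lhf P) (squares P) Y n D_src l s)%fset.

End BlockTree.

Section Matrices.
Variables (R : realType) (m : nat) (k : R).

Definition expi (x : R) : R[i] := (cos x +i* sin x)%C.

(* A flat index nu in {0,...,m}^3; matrix rows and columns are indexed by its
   rank in the enumeration of this type. *)
Definition tidx := {ffun 'I_3 -> 'I_m.+1}.

Definition cheb (a b : R) (j : 'I_m.+1) : R :=
  (a + b) / 2 + (b - a) / 2 * cos ((j.*2.+1)%:R * pi / (m.+1.*2)%:R).

Definition node (t : box R) (nu : tidx) : point R :=
  \row_i cheb (t.1 ord0 i) (t.2 ord0 i) (nu i).

Definition lagrange (t : box R) (nu : tidx) (x : point R) : R :=
  \prod_(i < 3) \prod_(j < m.+1 | j != nu i)
    ((x ord0 i - cheb (t.1 ord0 i) (t.2 ord0 i) j) /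
     (cheb (t.1 ord0 i) (t.2 ord0 i) (nu i) -
      cheb (t.1 ord0 i) (t.2 ord0 i) j)).

Definition interp_mx (X : cloud R) (t : box R) (c : point R) :
    'M[R[i]]_(#|indices X t|, #|{: tidx}|) :=
  \matrix_(j, a)
    ((lagrange t (enum_val a) (pts X (enum_val j)))%:C%C *
     expi (k * dotp (pts X (enum_val j)) c)).

(* For a child t' of t; c' is the direction that replaces c on the level
   of t'. *)
Definition transfer_mx (t t' : box R) (c c' : point R) :
    'M[R[i]]_(#|{: tidx}|, #|{: tidx}|) :=
  \matrix_(a, b)
    (expi (k * dotp (node t' (enum_val a)) (c - c')) *
     (lagrange t (enum_val b) (node t' (enum_val a)))%:C%C).

Definition coupling_mx (c : point R) (t s : box R) :
    'M[R[i]]_(#|{: tidx}|, #|{: tidx}|) :=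
  \matrix_(a, b)
    let z := node t (enum_val a) - node s (enum_val b) in
    expi (k * (enorm z - dotp z c)) / (4 * pi * enorm z)%:C%C.

Definition system_mx (X Y : cloud R) : 'M[R[i]]_(npts X, npts Y) :=
  \matrix_(i, j)
    let r := enorm (pts X i - pts Y j) in
    expi (k * r) / (4 * pi * r)%:C%C.

Definition near_mx (X Y : cloud R) (t s : box R) :
    'M[R[i]]_(#|indices X t|, #|indices Y s|) :=
  mxsub (fun i => enum_val i) (fun j => enum_val j) (system_mx X Y).

End Matrices.

Section Algorithm.
Variables (R : realType) (m : nat) (eta2 : R) (P : problem R).

Record any_mx := AnyMx {
  nrows : nat;
  ncols : nat;
  mxval : 'M[R[i]]_(nrows, ncols) }.

Definition entries (A : any_mx) : nat := (nrows A * ncols A)%N.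

Notation X := (trg P).
Notation Y := (src P).
Notation n := (nmax P).
Notation k := (kappa P).

(* The matrices that the six steps apply, each exactly once. Those of steps 1
   and 2 are applied in conjugate transposed form, which does not change the
   number of entries. *)

Definition step1 : seq any_mx :=
  flatten [seq [seq AnyMx (interp_mx m k Y s c) |
                  s <- leaves_at Y n l, c <- dirs_src eta2 P l s]
          | l <- iota 0 (depth_src P).+1].

Definition step2 : seq any_mx :=
  flatten [seq flatten [seq [seq AnyMx (transfer_mx m k s s' c
                                          (dir_at P l.+1 c)) |
                               c <- dirs_src eta2 P l s, s' <- child Y n s]
                       | s <- inner_at Y n l]
          | l <- rev (iota 0 (depth_src P))].

Definition step3 : seq any_mx :=
  flatten [seq [seq AnyMx (coupling_mx m k (dir_block P l b.1 b.2) b.1 b.2)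
               | b <- farfield_at eta2 P l]
          | l <- iota 0 (pmax P).+1].

Definition step4 : seq any_mx :=
  flatten [seq flatten [seq [seq AnyMx (transfer_mx m k t t' c
                                          (dir_at P l.+1 c)) |
                               c <- dirs_trg eta2 P l t, t' <- child X n t]
                       | t <- inner_at X n l]
          | l <- iota 0 (depth_trg P)].

Definition step5 : seq any_mx :=
  flatten [seq [seq AnyMx (interp_mx m k X t c) |
                  t <- leaves_at X n l, c <- dirs_trg eta2 P l t]
          | l <- iota 0 (depth_trg P).+1].

Definition step6 : seq any_mx :=
  [seq AnyMx (near_mx k X Y b.1 b.2) | b <- nearfield eta2 P].

Definition complexity : nat :=
  \sum_(A <- step1 ++ step2 ++ step3 ++ step4 ++ step5 ++ step6) entries A.

End Algorithm.

(* Main.v *)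
(* The work in a step is the number of its matrices, up to a constant. A level l
   of a cluster tree has at most 8^l boxes, each with at most 6*4^(p-l+c)
   directions, which sums up to O(8^p) = O(N) for the depth p. A block of level
   l+1 has a parent (t,s) violating (A1) or (A3); writing d = q_0/2^l, its boxes
   have distance O(d + kappa*d^2), and the boxes of level l lie on a grid with
   spacing comparable to d, so that t has O(1 + (kappa*d)^3) such partners. This
   gives O(8^l + (kappa*q_0)^3) blocks per level, and the second term, multiplied
   by the number of levels, decides between O(N log N) and O(N). In the nearfield
   a non-outlying leaf costs O(1), and an outlying one O(N), since the boxes
   paired with it belong to one level and are disjoint. *)
Require Import Defs.
From mathcomp Require Import all_boot all_order all_algebra finmap.
From mathcomp Require Import all_classical all_reals all_analysis.
From mathcomp Require Import zify ring lra.
(* Again, as mathcomp-analysis shadows [point]. *)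
Import Defs.
Import Order.TTheory GRing.Theory Num.Theory.
Local Open Scope ring_scope.

Set Implicit Arguments.
Unset Strict Implicit.
Unset Printing Implicit Defensive.

(** * Finite sums and cardinalities *)

Lemma uniq_mem1_size (T : eqType) (r : seq T) :
  uniq r -> {in r &, forall x y, x = y} -> (size r <= 1)%N.
Proof.
case: r => [//|x r] ur rP; apply: (@uniq_leq_size _ _ [:: x]) => // y ry.
by rewrite inE (rP y x) ?mem_head.
Qed.

Lemma card_bigfcup_sum_le (I T : choiceType) (r : seq I) (F : I -> {fset T}) :
  (#|` \bigcup_(i <- r) F i|%fset <= \sum_(i <- r) #|` F i|)%N.
Proof.
elim: r => [|i r IHr]; first by rewrite !big_nil cardfs0.
by rewrite !big_cons (leq_trans (leq_card_fsetU _ _)) ?leq_add2l.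
Qed.

Lemma card_fsetM (T U : choiceType) (A : {fset T}) (B : {fset U}) :
  (#|` A `*` B|%fset <= #|` A| * #|` B|)%N.
Proof.
rewrite -[leqRHS](size_allpairs pair) uniq_leq_size ?fset_uniq// => -[a b].
by rewrite in_fsetM => /andP[aA bB]; apply/allpairsP; exists (a, b).
Qed.

(* In [ring_scope] the sum iterates the addition of the semiring [nat], which is
   only convertible to [addn]. *)
Lemma sum_ringE (T : Type) (r : seq T) (F : T -> nat) :
  \sum_(x <- r) F x = (\sum_(x <- r) F x)%N.
Proof. by []. Qed.

Lemma sum_le_size (I : eqType) (r : seq I) (F : I -> nat) (c : nat) :
  (forall i, i \in r -> F i <= c)%N -> (\sum_(i <- r) F i <= size r * c)%N.
Proof.
move=> Fc; rewrite -sum1_size big_distrl /= big_seq [leqRHS]big_seq.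
by apply: leq_sum => i /Fc; rewrite mul1n.
Qed.

(** Exchanging the two sums, each [b] on the left is counted on the right at [s = p b]. *)
Lemma sum_by_value_le (T U : eqType) (B : seq U) (p : U -> T) (L : seq T) (F : U -> nat) :
  (\sum_(b <- B | p b \in L) F b <= \sum_(s <- L) \sum_(b <- B | p b == s) F b)%N.
Proof.
under [leqRHS]eq_bigr do rewrite big_mkcond.
rewrite exchange_big /= big_mkcond /=; apply: leq_sum => b _.
case: ifPn => // pL; rewrite (perm_big _ (perm_to_rem pL)) big_cons eqxx.
exact: leq_addr.
Qed.

(** Abstract form of the nearfield estimate. The blocks are grouped by their leaf component [p b],
    whose own weight [w2] is at most [n]. A group then contributes at most [c * c'] through [w1] if
    its leaf is ordinary, and at most [N] if the leaf belongs to the exceptional set [O]. *)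
Lemma near_sum_le (T U : eqType) (B : seq U) (p : U -> T) (w1 w2 : U -> nat)
    (L O : seq T) (c c' n N : nat) :
  uniq L ->
  (forall b, b \in B -> p b \in L -> w2 b <= n)%N ->
  (forall s, s \in L -> s \notin O ->
     (size [seq b <- B | p b == s] <= c)%N /\
     forall b, b \in B -> p b = s -> (w1 b <= c')%N) ->
  (forall s, s \in O -> \sum_(b <- B | p b == s) w1 b <= N)%N ->
  (\sum_(b <- B | p b \in L) w1 b * w2 b <= n * (size L * (c * c') + size O * N))%N.
Proof.
move=> uL w2n cP NP.
apply: (@leq_trans (\sum_(b <- B | p b \in L) w1 b * n)).
  rewrite big_seq_cond [leqRHS]big_seq_cond; apply: leq_sum => b /andP[bB bL].
  by rewrite leq_mul2l w2n ?orbT.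
rewrite -big_distrl /= mulnC leq_mul2l; apply/orP; right.
apply: (leq_trans (sum_by_value_le _ _ _ _)).
rewrite (bigID [in O]) /= addnC leq_add//.
  apply: (@leq_trans (\sum_(s <- L | s \notin O) c * c')).
    rewrite big_seq_cond [leqRHS]big_seq_cond; apply: leq_sum => s /andP[sL sO].
    have [cs c's] := cP s sL sO; rewrite -big_filter.
    apply: leq_trans (leq_mul cs (leqnn c')).
    by apply: sum_le_size => b; rewrite mem_filter => /andP[/eqP pb bB]; exact: c's.
  rewrite big_mkcond /=; apply: (leq_trans (sum_le_size (c := c * c') _)) => // s _.
  by case: ifP.
rewrite -big_filter; apply: (@leq_trans (size [seq s <- L | s \in O] * N)).
  by apply: sum_le_size => s; rewrite mem_filter => /andP[sO _]; exact: NP.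
rewrite leq_mul2r; apply/orP; right; apply: uniq_leq_size; first exact: filter_uniq.
by move=> s; rewrite mem_filter => /andP[].
Qed.

(** * Geometric sums over the levels *)

Lemma sum_pow2_le p : (\sum_(l <- iota 0 p.+1) 2 ^ l <= 2 ^ p.+1)%N.
Proof.
elim: p => [|p IHp]; first by rewrite big_seq1.
by rewrite -[in iota _ _]addn1 iotaD big_cat big_seq1 add0n /= [leqRHS]expnSr
  muln2 -addnn leq_add2r.
Qed.

Lemma sum_pow8_le p : (\sum_(l <- iota 0 p.+1) 8 ^ l <= 2 * 8 ^ p)%N.
Proof.
elim: p => [|p IHp]; first by rewrite big_seq1.
rewrite -[in iota _ _]addn1 iotaD big_cat big_seq1 add0n.
by apply: leq_trans (leq_add IHp (leqnn _)) _; rewrite [(8 ^ p.+1)%N]expnSr; lia.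
Qed.

(** Writing 8^l = 4^l * 2^l, the factor 4^l cancels the decay of the number of directions, and a
    geometric sum of powers of 2 remains. *)
Lemma sum_dirs_le p q c : (q <= p)%N ->
  (\sum_(l <- iota 0 q.+1) 8 ^ l * (6 * 4 ^ (p + c - l)) <= 12 * 4 ^ c * 8 ^ p)%N.
Proof.
move=> qp; apply: (@leq_trans (\sum_(l <- iota 0 q.+1) 6 * 4 ^ (p + c) * 2 ^ l)).
  rewrite big_seq [leqRHS]big_seq; apply: leq_sum => l; rewrite mem_iota /= => lq.
  rewrite mulnCA -mulnA leq_mul2l /= -[8%N]/(4 * 2)%N expnMn mulnC mulnA -expnD subnK//.
  by rewrite (leq_trans _ (leq_addr _ _))// (leq_trans _ qp).
rewrite -big_distrr /= (leq_trans (leq_mul (leqnn _) (sum_pow2_le q)))//.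
apply: (@leq_trans (6 * 4 ^ (p + c) * 2 ^ p.+1)).
  by rewrite leq_mul2l leq_pexp2l ?orbT.
by rewrite expnSr expnD -[8%N]/(4 * 2)%N expnMn; lia.
Qed.

(** * Elementary real estimates *)

Lemma cube_1D (R : realType) (x : R) : 0 <= x -> (1 + x) ^+ 3 <= 4 * (1 + x ^+ 3).
Proof.
move=> x0; rewrite -subr_ge0.
have -> : 4 * (1 + x ^+ 3) - (1 + x) ^+ 3 = 3 * ((1 + x) * (1 - x) ^+ 2) by ring.
by rewrite mulr_ge0 ?ler0n// mulr_ge0 ?sqr_ge0 ?addr_ge0.
Qed.

Lemma powR_cbrtK (R : realType) (a : R) : 0 <= a -> (a `^ 3^-1) ^+ 3 = a.
Proof.
by move=> a0; rewrite -powR_mulrn ?powR_ge0// -powRrM mulVf ?powRr1.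
Qed.

(** Exponentiation turns the additive constant [c_ad] of the depth into the factor 8^c_ad, written
    [expR (c_ad * ln 8)]. *)
Lemma pow8_depth_le (R : realType) (N c_ad : R) p : 0 < N ->
  p%:R <= ln N / ln 8 + c_ad -> 8 ^+ p <= N * expR (c_ad * ln 8).
Proof.
move=> N0 pN; have l8 : 0 < ln 8 :> R by rewrite ln_gt0// ltr1n.
rewrite -[8 in leLHS]lnK ?posrE// -expRM_natl -[N in leRHS]lnK ?posrE// -expRD ler_expR.
by rewrite (le_trans (ler_wpM2r (ltW l8) pN))// mulrDl divfK ?gt_eqF.
Qed.

(** * Boxes and cluster trees *)

Section Boxes.

Variable R : realType.
Implicit Types (t s : box R) (x y : point R).

Lemma coord_le_enorm x i : `|x ord0 i| <= enorm x.
Proof.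
rewrite -sqrtr_sqr ler_wsqrtr// /dotp (bigD1 i)//= expr2 lerDl.
by apply: sumr_ge0 => j _; rewrite -expr2 sqr_ge0.
Qed.

(** Squaring leaves only the nonnegative mixed products of the absolute coordinates. *)
Lemma enorm_le_sum x : enorm x <= \sum_(i < 3) `|x ord0 i|.
Proof.
have s0 : 0 <= \sum_(i < 3) `|x ord0 i| by exact: sumr_ge0.
rewrite -[leRHS]ger0_norm// -sqrtr_sqr ler_wsqrtr// /dotp.
rewrite !big_ord_recr !big_ord0 /= !add0r.
set a := x _ _; set b := x _ _; set c := x _ _.
have [] : [/\ 0 <= `|a| * `|b|, 0 <= `|a| * `|c| & 0 <= `|b| * `|c|] by rewrite !mulr_ge0.
have -> : a * a = `|a| ^+ 2 by rewrite real_normK// num_real.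
have -> : b * b = `|b| ^+ 2 by rewrite real_normK// num_real.
have -> : c * c = `|c| ^+ 2 by rewrite real_normK// num_real.
nra.
Qed.

Lemma in_box_coord t x i : in_box t x -> t.1 ord0 i < x ord0 i <= t.2 ord0 i.
Proof. by move=> /forallP/(_ i). Qed.

Lemma upper_corner_in t : (forall i, 0 < side t i) -> in_box t t.2.
Proof. by move=> t0; apply/forallP => i; have := t0 i; rewrite /side; lra. Qed.

Lemma enorm_diff_le_sides t x y : in_box t x -> in_box t y ->
  enorm (x - y) <= \sum_(i < 3) side t i.
Proof.
move=> tx ty; apply: (le_trans (enorm_le_sum _)); apply: ler_sum => i _.
have := in_box_coord i tx; have := in_box_coord i ty.
by rewrite !mxE /side ler_norml; lra.
Qed.

Lemma diam_le_sides t : (forall i, 0 < side t i) ->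
  diam t <= \sum_(i < 3) side t i.
Proof.
move=> t0; apply: ge_sup.
  have tt := upper_corner_in t0.
  by exists (enorm (t.2 - t.2)), t.2 => //; exists t.2.
by move=> _ [x tx [y ty <-]]; exact: enorm_diff_le_sides.
Qed.

(** The box is open below, so the side length is only approached: the upper corner is compared with
    the point [y] that differs from it in coordinate [i] alone and lies [d] above the lower face.
    The bound [d <= side t i / 2] keeps [y] inside. *)
Lemma side_le_diam t i : (forall j, 0 < side t j) -> side t i <= diam t.
Proof.
move=> t0; apply/ler_addgt0Pr => e e0.
pose d := Num.min e (side t i / 2).
have d0 : 0 < d by rewrite lt_min e0 divr_gt0.
have de : d <= e by rewrite ge_min lexx.
have ds : d <= side t i / 2 by rewrite ge_min lexx orbT.
pose y : point R := \row_j (if j == i then t.1 ord0 i + d else t.2 ord0 j).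
have ty : in_box t y.
  apply/forallP => j; rewrite mxE; have := t0 j; have := t0 i.
  by case: eqP => [->|_]; rewrite /side in ds *; lra.
have : side t i - d <= enorm (t.2 - y).
  apply: le_trans (coord_le_enorm _ i); rewrite !mxE eqxx /side.
  by apply: le_trans (ler_norm _); lra.
have : enorm (t.2 - y) <= diam t.
  apply: ub_le_sup; last by exists t.2; [exact: upper_corner_in|exists y].
  exists (\sum_(i < 3) side t i) => _ [u tu [v tv <-]].
  exact: enorm_diff_le_sides.
lra.
Qed.

Lemma dist_lt t s r : (forall i, 0 < side t i) -> (forall i, 0 < side s i) ->
  dist t s < r -> exists x y, [/\ in_box t x, in_box s y & enorm (x - y) < r].
Proof.
move=> t0 s0 /inf_lt[].
  have tt := upper_corner_in t0; have ss := upper_corner_in s0.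
  by exists (enorm (t.2 - s.2)), t.2 => //; exists s.2.
by move=> _ [x tx [y sy <-]] xy; exists x, y.
Qed.

(** Two points realizing a distance below [r] differ from the lower corners of their boxes by at
    most one side length each. *)
Lemma corner_dist t s r i : (forall i, 0 < side t i) -> (forall i, 0 < side s i) ->
  dist t s < r -> `|s.1 ord0 i - t.1 ord0 i| < side t i + side s i + r.
Proof.
move=> t0 s0 /(dist_lt t0 s0)[x [y [tx sy xy]]].
have := le_lt_trans (coord_le_enorm _ i) xy.
have := in_box_coord i tx; have := in_box_coord i sy.
by rewrite !mxE /side !ltr_norml; lra.
Qed.

End Boxes.

(** * Levels of a cluster tree: size, grid structure, disjointness *)

Section Tree.

Variables (R : realType) (X : cloud R) (n : nat).
Implicit Types (t s : box R) (l : nat).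

Lemma card_subboxes t : (#|` subboxes t| <= 8)%N.
Proof.
apply: (leq_trans (leq_imfset_card _ _ _)).
by rewrite -cardE card_ffun card_bool card_ord.
Qed.

Lemma card_child t : (#|` child X n t| <= 8)%N.
Proof.
rewrite /child; case: ifP => _; first by rewrite cardfs0.
apply: leq_trans (card_subboxes t); apply/fsubset_leq_card/fsubsetP => s.
by rewrite !inE => /andP[].
Qed.

Lemma size_level l : (size (level X n l) <= 8 ^ l)%N.
Proof.
elim: l => [|l IHl] /=; first by rewrite cardfs1.
apply: (leq_trans (card_bigfcup_sum_le _ _)).
apply: (leq_trans (sum_le_size (fun t _ => card_child t))).
by rewrite expnSr leq_mul2r.
Qed.

Lemma side_level_gt0 l t i : t \in level X n l -> 0 < side t i.
Proof. by move=> /side_level->; rewrite divr_gt0 ?exprn_gt0 ?root_box_gt0. Qed.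

(** The side length determines the level, being halved at each subdivision. *)
Lemma level_inj l k t : t \in level X n l -> t \in level X n k -> l = k.
Proof.
move=> tl tk; have := side_level ord0 tl; rewrite (side_level ord0 tk).
move/(mulfI (lt0r_neq0 (root_box_gt0 X ord0)))/invr_inj/eqP.
by rewrite -!natrX eqr_nat eqn_exp2l// => /eqP.
Qed.

Lemma level_sub_depth l t : (0 < n)%N -> t \in level X n l -> (l <= depth X n)%N.
Proof.
move=> n0 tl; rewrite leqNgt; apply/negP => dl.
have : level X n l = fset0.
  rewrite -(subnK dl); elim: (_ - _)%N => [|k IHk].
    by have [_ <-] := depthP X n0.
  by rewrite addSn /= IHk big_nil.
by move=> l0; rewrite l0 in tl.
Qed.

Lemma corner_level l t : t \in level X n l -> exists z : 'I_3 -> nat,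
  forall i, t.1 ord0 i =
    (root_box X).1 ord0 i + (z i)%:R * (side (root_box X) i / 2 ^+ l).
Proof.
elim: l t => [|l IHl] t /=.
  by move=> /fset1P ->; exists (fun=> 0%N) => i; rewrite mul0r addr0.
move=> /bigfcupP [u /andP [ul _]]; rewrite /child; case: ifP => // _.
rewrite !inE => /andP [] /imfsetP [] o _ -> _.
have [z zP] := IHl u ul.
have sul i := side_level i ul.
(* Halving the spacing doubles the grid index, and choosing the upper half adds one new spacing. *)
exists (fun i => (2 * z i + o i)%N) => i.
have e : u.2 ord0 i = u.1 ord0 i + side u i by rewrite /side addrC subrK.
rewrite exprS invfM /subbox /= /midpoint !mxE.
case: (o i); rewrite ?mxE ?e ?sul zP natrD natrM /=; field; exact: expf_neq0.
Qed.

(* The corners of the boxes of a level lie on a grid with the side lengths of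
   these boxes as spacing. *)
Lemma level_sep l t s : t \in level X n l -> s \in level X n l ->
  (forall i, `|t.1 ord0 i - s.1 ord0 i| < side (root_box X) i / 2 ^+ l) -> t = s.
Proof.
move=> tl sl ts.
have e1 i : t.1 ord0 i = s.1 ord0 i.
  have [z zP] := corner_level tl; have [w wP] := corner_level sl.
  have := ts i; rewrite zP wP; set h := _ / _.
  have h0 : 0 < h by rewrite /h divr_gt0 ?exprn_gt0 ?root_box_gt0.
  rewrite opprD addrACA subrr add0r -mulrBl normrM (gtr0_norm h0) gtr_pMl//.
  have -> : `|(z i)%:R - (w i)%:R| = `|(z i)%:Z - (w i)%:Z|%:~R :> R.
    by rewrite intr_norm rmorphB.
  rewrite -[1]/1%:~R ltr_int => zw.
  by have -> : z i = w i by lia.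
rewrite [t]surjective_pairing [s]surjective_pairing.
have -> : t.1 = s.1 by apply/rowP => i; rewrite e1.
congr pair; apply/rowP => i.
have := side_level i tl; rewrite -(side_level i sl) /side e1.
by apply: addIr.
Qed.

(** A common point forces the lower corners to be less than one grid spacing apart in every
    coordinate. *)
Lemma level_disjoint l t s x : t \in level X n l -> s \in level X n l ->
  in_box t x -> in_box s x -> t = s.
Proof.
move=> tl sl tx sx; apply: (level_sep tl sl) => i.
have := in_box_coord i tx; have := in_box_coord i sx.
have := side_level i tl; have := side_level i sl; rewrite /side.
set h := _ / _ => <- ?; rewrite ltr_norml; lra.
Qed.

(** Double counting: by disjointness, each point lies in at most one of the boxes. *)
Lemma sum_indices_le l (r : seq (box R)) :
  uniq r -> {subset r <= level X n l} -> (\sum_(t <- r) #|indices X t| <= npts X)%N.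
Proof.
move=> ur rl.
under eq_bigr do rewrite -sum1_card big_mkcond /=.
rewrite exchange_big /= -[leqRHS]card_ord -sum1_card leq_sum// => j _.
rewrite -big_mkcond /= sum1_count -size_filter.
apply: uniq_mem1_size; first exact: filter_uniq.
move=> t s; rewrite !mem_filter !inE => /andP[tj /rl tl] /andP[sj /rl sl].
exact: (level_disjoint tl sl tj sj).
Qed.

End Tree.

(** * Counting blocks *)

Section Counting.

(** Each box is sent to the integer parts of its corner's offsets from [lo], measured in grid
    spacings. Boxes with equal integer parts are less than a spacing apart and coincide by
    [level_sep], so the map is injective into a cube of ([truncn W] + 1)^3 indices. *)
Lemma size_level_window (R : realType) (X : cloud R) (n l : nat) (r : seq (box R))
    (lo : 'I_3 -> R) (W : R) :
  uniq r -> {subset r <= level X n l} ->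
  (forall t i, t \in r ->
     lo i <= t.1 ord0 i < lo i + W * (side (root_box X) i / 2 ^+ l)) ->
  (size r <= (Num.truncn W).+1 ^ 3)%N.
Proof.
move=> ur rl rlo.
pose h i := side (root_box X) i / 2 ^+ l.
have h0 i : 0 < h i by rewrite divr_gt0 ?exprn_gt0 ?root_box_gt0.
pose g (t : box R) i := (t.1 ord0 i - lo i) / h i.
have g0 t i : t \in r -> 0 <= g t i.
  by move=> /rlo-/(_ i)/andP[? _]; rewrite divr_ge0 ?subr_ge0 ?(ltW (h0 i)).
have gW t i : t \in r -> (Num.truncn (g t i) < (Num.truncn W).+1)%N.
  move=> tr; rewrite ltnS le_truncn// ler_pdivrMr// lerBlDl.
  by have /andP[_ /ltW] := rlo t i tr.
pose f t : {ffun 'I_3 -> 'I_(Num.truncn W).+1} :=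
  [ffun i => inord (Num.truncn (g t i))].
have f_inj : {in r &, injective f}.
  move=> t s tr sr /ffunP fts; apply: (level_sep (rl _ tr) (rl _ sr)) => i.
  have := congr1 (@nat_of_ord _) (fts i); rewrite !ffunE !inordK ?gW// => e.
  have := truncn_itv (g0 _ i tr); have := truncn_itv (g0 _ i sr).
  rewrite e => a b; rewrite -[ltRHS]mul1r -ltr_pdivrMr ?h0// -/(h i).
  have -> : t.1 ord0 i - s.1 ord0 i = (g t i - g s i) * h i.
    by rewrite /g -mulrBl divfK ?gt_eqF// opprB addrA subrK.
  rewrite normrM (gtr0_norm (h0 i)) mulfK ?gt_eqF// ltr_norml.
  move: a b; rewrite -natr1; lra.
have <- : #|{ffun 'I_3 -> 'I_(Num.truncn W).+1}| = ((Num.truncn W).+1 ^ 3)%N.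
  by rewrite card_ffun !card_ord.
rewrite -(size_map f) cardE uniq_leq_size// ?map_inj_in_uniq// => y _.
by rewrite mem_enum.
Qed.

Variables (R : realType) (eta2 : R) (P : problem R).
Hypothesis eta2_gt0 : 0 < eta2.
Notation X := (trg P).
Notation Y := (src P).
Notation n := (nmax P).

Lemma side_trg_le_q0 i : side (root_box X) i <= q0 P.
Proof. by rewrite /q0 le_max side_le_diam// => j; exact: root_box_gt0. Qed.

Lemma side_src_le_q0 i : side (root_box Y) i <= q0 P.
Proof. by rewrite /q0 le_max orbC side_le_diam// => j; exact: root_box_gt0. Qed.

Lemma q0_gt0 : 0 < q0 P.
Proof. exact: lt_le_trans (root_box_gt0 X ord0) (side_trg_le_q0 _). Qed.

Lemma diam_level_le (Z : cloud R) l t q : t \in level Z n l ->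
  (forall i, side (root_box Z) i <= q) -> diam t <= 3 * (q / 2 ^+ l).
Proof.
move=> tl hq; apply: (le_trans (diam_le_sides (fun i => side_level_gt0 i tl))).
have -> : 3 * (q / 2 ^+ l) = \sum_(i < 3) (q / 2 ^+ l).
  by rewrite sumr_const card_ord mulr_natl.
by apply: ler_sum => i _; rewrite (side_level i tl) ler_pM2r ?invr_gt0 ?exprn_gt0.
Qed.

(** Diameters on level [l] are at most 3d, so a violation of (A1) or (A3) bounds the distance by (3d
    + 9 kappa d^2) / [eta2]. Hence the corner of [s] lies in a window around that of [t], and the
    grid limits the number of such corners. *)
Lemma size_nonadm (w : R) l t :
  (forall i, q0 P <= w * side (root_box Y) i) -> t \in level X n l ->
  (size [seq s <- level Y n l | ~~ adm eta2 P (t, s)])%:R <=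
  4 * (1 + 2 * w * (2 + 9 / eta2)) ^+ 3 * (1 + (kappa P * (q0 P / 2 ^+ l)) ^+ 3).
Proof.
move=> qw tl; set d := q0 P / 2 ^+ l; set x := kappa P * d.
have d0 : 0 < d by rewrite divr_gt0 ?q0_gt0 ?exprn_gt0.
have x0 : 0 < x by rewrite mulr_gt0 ?kappa_gt0.
have w0 : 0 < w.
  by rewrite -(pmulr_lgt0 _ (root_box_gt0 Y ord0)) (lt_le_trans q0_gt0).
have i0 : 0 < eta2^-1 by rewrite invr_gt0.
(* The full width of the window in units of [d / w], which is at most the grid spacing of the source
   level. The inner 2 accounts for the sides of [t] and [s]. *)
pose W := 2 * w * (2 + (3 + 9 * x) / eta2).
have WE : W = 4 * w + 6 * (w / eta2) + 18 * (w / eta2 * x).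
  by rewrite /W; field; rewrite gt_eqF.
have we0 : 0 < w / eta2 by rewrite divr_gt0.
have wx0 : 0 < w / eta2 * x by rewrite mulr_gt0.
have W0 : 0 <= W by rewrite WE; lra.
apply: (@le_trans _ _ (((Num.truncn W).+1 ^ 3)%:R)).
  rewrite ler_nat; apply: (@size_level_window _ Y n l _
    (fun i => t.1 ord0 i - (2 * d + (3 * d + 9 * (x * d)) / eta2))).
  - by rewrite filter_uniq// fset_uniq.
  - by move=> s; rewrite mem_filter => /andP[].
  move=> s i; rewrite mem_filter => /andP[nadm sl].
  have t0 j : 0 < side t j by exact: side_level_gt0 tl.
  have s0 j : 0 < side s j by exact: side_level_gt0 sl.
  have M3 : Num.max (diam t) (diam s) <= 3 * d.
    rewrite ge_max (diam_level_le tl side_trg_le_q0).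
    exact: (diam_level_le sl side_src_le_q0).
  have M0 : 0 <= Num.max (diam t) (diam s).
    by rewrite le_max (le_trans (ltW (t0 ord0)))// side_le_diam.
  have dts : dist t s < (3 * d + 9 * (x * d)) / eta2.
    rewrite ltr_pdivlMr// mulrC.
    have xd0 : 0 < x * d by rewrite mulr_gt0.
    move: nadm; rewrite /adm /critA1 /critA3 /= negb_and -!ltNge => /orP[] H.
      by apply: (lt_le_trans H); lra.
    apply: (lt_le_trans H).
    have : kappa P * Num.max (diam t) (diam s) ^+ 2 <= kappa P * (3 * d) ^+ 2.
      by rewrite ler_pM2l ?kappa_gt0// lerXn2r ?nnegrE// mulr_ge0 ?ltW.
    have -> : kappa P * (3 * d) ^+ 2 = 9 * (x * d) by rewrite /x; ring.
    lra.
  have := corner_dist i t0 s0 dts.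
  have td : side t i <= d.
    by rewrite (side_level i tl) ler_pM2r ?side_trg_le_q0 ?invr_gt0 ?exprn_gt0.
  have sd : side s i <= d.
    by rewrite (side_level i sl) ler_pM2r ?side_src_le_q0 ?invr_gt0 ?exprn_gt0.
  have : 2 * (2 * d + (3 * d + 9 * (x * d)) / eta2) <=
         W * (side (root_box Y) i / 2 ^+ l).
    have -> : 2 * (2 * d + (3 * d + 9 * (x * d)) / eta2) = W / w * d.
      by rewrite /W; field; rewrite !gt_eqF.
    by rewrite -mulrA ler_wpM2l// ler_pdivrMl// mulrA /d ler_pM2r.
  rewrite ltr_norml; lra.
rewrite natrX.
(* As [W] is affine in [x], 1 + [W] is at most a constant times 1 + [x]; [cube_1D] then separates
   the cube of [x]. *)
apply: (@le_trans _ _ (((1 + 2 * w * (2 + 9 / eta2)) * (1 + x)) ^+ 3)).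
  rewrite lerXn2r ?nnegrE//.
    by rewrite mulr_ge0// addr_ge0// ?ltW// !mulr_gt0// addr_gt0// mulr_gt0.
  rewrite -natr1; have : (Num.truncn W)%:R <= W by rewrite truncn_le.
  rewrite WE => ?.
  have wx : 0 < w * x by rewrite mulr_gt0.
  have -> : (1 + 2 * w * (2 + 9 / eta2)) * (1 + x) =
    1 + x + 4 * w + 4 * (w * x) + 18 * (w / eta2) + 18 * (w / eta2 * x).
    by field; rewrite gt_eqF.
  lra.
rewrite exprMn -[leRHS]mulrA [leRHS]mulrCA ler_wpM2l ?cube_1D ?ltW//.
by rewrite exprn_gt0// addr_gt0// !mulr_gt0// addr_gt0// mulr_gt0.
Qed.

End Counting.

(** * Numbers of blocks and directions, and entries in steps 1 to 5 *)

Section Work.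

Variables (R : realType) (eta2 : R) (P : problem R).
Notation X := (trg P).
Notation Y := (src P).
Notation n := (nmax P).

Lemma blocks_level l b : b \in blocks eta2 P l ->
  (b.1 \in level X n l) && (b.2 \in level Y n l).
Proof.
elim: l b => [|l IHl] b /=; first by move=> /fset1P ->; rewrite !inE !eqxx.
move=> /bigfcupP[u /andP[/IHl/andP[u1 u2] _]]; rewrite /block_child.
case: ifP => // _; rewrite in_fsetM => /andP[b1 b2].
by apply/andP; split; apply/bigfcupP; [exists u.1|exists u.2]; rewrite ?u1 ?u2.
Qed.

(** Only inadmissible pairs are subdivided, each into at most 8 * 8 children. *)
Lemma size_blocksS l : (size (blocks eta2 P l.+1) <=
  64 * \sum_(t <- level X n l) size [seq s <- level Y n l | ~~ adm eta2 P (t, s)])%N.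
Proof.
apply: (leq_trans (card_bigfcup_sum_le _ _)).
apply: (@leq_trans (\sum_(b <- blocks eta2 P l | ~~ block_leaf eta2 P b) 64)).
  rewrite [leqRHS]big_mkcond; apply: leq_sum => b _.
  rewrite /block_child; case: ifP => _; first by rewrite cardfs0.
  apply: leq_trans (card_fsetM _ _) _.
  exact: (@leq_mul _ _ 8 8 (card_child _ _ _) (card_child _ _ _)).
rewrite -big_filter big_const_seq count_predT iter_addn_0 leq_mul2l /=.
apply: (@leq_trans (size [seq (t, s) | t <- level X n l,
    s <- [seq s <- level Y n l | ~~ adm eta2 P (t, s)]])); last first.
  by rewrite size_allpairs_dep sumnE big_map.
apply: uniq_leq_size; first by rewrite filter_uniq ?fset_uniq.
move=> [t s]; rewrite mem_filter /block_leaf /= !negb_or => /andP[/and3P[_ _ nadm]].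
move=> /blocks_level/andP[tl sl]; apply/allpairsPdep; exists t, s.
by rewrite mem_filter nadm.
Qed.

Lemma size_dirset l p c : lhf P + 1 <= (p + c)%:Z -> (l <= p)%N ->
  (size (dirset (lhf P) (squares P) l) <= 6 * 4 ^ (p + c - l))%N.
Proof.
move=> hp lp; rewrite /dirset; case: ifPn => [_|].
  by rewrite cardfs1 muln_gt0 expn_gt0.
rewrite -leNgt => hl; apply: (leq_trans (leq_imfset_card _ _ _)).
by rewrite -cardE card_ord leq_mul2l leq_pexp2l//; lia.
Qed.

(** However directions are inherited, both sets stay inside the direction set of level [l]. *)
Lemma size_inherited_union (Z : cloud R) D l t c p :
  {subset D l t <= dirset (lhf P) (squares P) l} ->
  lhf P + 1 <= (p + c)%:Z -> (l <= p)%N ->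
  (size (D l t `|` inherited (lhf P) (squares P) Z n D l t)%fset <=
   6 * 4 ^ (p + c - l))%N.
Proof.
move=> Dl hp lp; apply: leq_trans (size_dirset hp lp).
apply/fsubset_leq_card/fsubsetP => v; rewrite in_fsetU => /orP[/Dl //|].
by case: {Dl lp} l => [|l] /=; rewrite ?inE // => /andP[].
Qed.

Lemma size_dirs_trg l t c p : lhf P + 1 <= (p + c)%:Z -> (l <= p)%N ->
  (size (dirs_trg eta2 P l t) <= 6 * 4 ^ (p + c - l))%N.
Proof.
by apply: size_inherited_union => v; rewrite !inE => /andP[].
Qed.

Lemma size_dirs_src l s c p : lhf P + 1 <= (p + c)%:Z -> (l <= p)%N ->
  (size (dirs_src eta2 P l s) <= 6 * 4 ^ (p + c - l))%N.
Proof.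
by apply: size_inherited_union => v; rewrite !inE => /andP[].
Qed.

Section Steps.
Variables (m : nat) (Z : cloud R) (k : R) (dr : nat -> box R -> {fset point R}).
Variables (r : seq nat) (d : nat -> nat).
Hypothesis dr_le : forall l t, l \in r -> (size (dr l t) <= d l)%N.

(** Covers steps 1 and 5 at once, with [dr] the direction sets of either tree: at most 8^l leaves,
    [d l] directions each, and matrices with at most [n] rows and (m+1)^3 columns. *)
Lemma interp_entries_le :
  (\sum_(A <- flatten [seq [seq AnyMx (interp_mx m k Z s c) |
       s <- leaves_at Z n l, c <- dr l s] | l <- r]) entries A <=
   n * #|{: tidx m}| * \sum_(l <- r) 8 ^ l * d l)%N.
Proof.
rewrite big_flatten big_map big_distrr /= big_seq [leqRHS]big_seq.
apply: leq_sum => l lr; rewrite big_allpairs_dep mulnC.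
apply: leq_trans (sum_le_size (c := d l * (n * #|{: tidx m}|)) _) _ => [s sl|].
  apply: leq_trans (sum_le_size (c := n * #|{: tidx m}|) _) _ => [c _|].
    by move: sl; rewrite !inE => /andP[_ sn]; rewrite leq_mul2r [X in _ || X]sn orbT.
  by rewrite leq_mul2r dr_le ?orbT.
rewrite mulnA leq_mul2r leq_mul2r (leq_trans _ (size_level Z n l)) ?orbT//.
by apply/fsubset_leq_card/fsubsetP => s; rewrite !inE => /andP[].
Qed.

(** Covers steps 2 and 4: at most 8^l inner boxes, [d l] directions and 8 children each. The change
    of direction [dd] does not affect the matrix sizes. *)
Lemma transfer_entries_le (dd : nat -> point R -> point R) :
  (\sum_(A <- flatten [seq flatten [seq [seq AnyMx (transfer_mx m k s s' c (dd l c)) |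
       c <- dr l s, s' <- child Z n s] | s <- inner_at Z n l] | l <- r]) entries A <=
   8 * #|{: tidx m}| ^ 2 * \sum_(l <- r) 8 ^ l * d l)%N.
Proof.
rewrite big_flatten big_map big_distrr /= big_seq [leqRHS]big_seq.
apply: leq_sum => l lr; rewrite big_flatten big_map mulnC.
apply: leq_trans (sum_le_size (c := d l * (8 * #|{: tidx m}| ^ 2)) _) _ => [s sl|].
  rewrite big_allpairs_dep.
  apply: leq_trans (sum_le_size (c := 8 * #|{: tidx m}| ^ 2) _) _ => [c _|].
    apply: leq_trans (sum_le_size (c := #|{: tidx m}| ^ 2) _) _ => [//|].
    by rewrite leq_mul2r card_child orbT.
  by rewrite leq_mul2r dr_le ?orbT.
rewrite mulnA leq_mul2r leq_mul2r (leq_trans _ (size_level Z n l)) ?orbT//.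
by apply/fsubset_leq_card/fsubsetP => s; rewrite !inE => /andP[].
Qed.

End Steps.

Lemma coupling_entries_le m (r : seq nat) :
  (\sum_(A <- flatten [seq [seq
       AnyMx (coupling_mx m (kappa P) (dir_block P l b.1 b.2) b.1 b.2)
       | b <- farfield_at eta2 P l] | l <- r]) entries A <=
   #|{: tidx m}| ^ 2 * \sum_(l <- r) size (blocks eta2 P l))%N.
Proof.
rewrite big_flatten big_map big_distrr /=; apply: leq_sum => l _; rewrite big_map mulnC.
apply: leq_trans (sum_le_size (c := #|{: tidx m}| ^ 2) _) _ => [//|].
rewrite leq_mul2r; apply/orP; right.
by apply/fsubset_leq_card/fsubsetP => s; rewrite !inE => /andP[].
Qed.

End Work.

(** * Nearfield *)

Section Near.

Variables (R : realType) (eta2 : R) (P : problem R).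
Notation X := (trg P).
Notation Y := (src P).
Notation n := (nmax P).
Notation NF := (nearfield eta2 P).

Lemma size_leaves (Z : cloud R) p : (depth Z n <= p)%N ->
  (size (leaves Z n) <= 2 * 8 ^ p)%N.
Proof.
move=> dp; apply: (@leq_trans (size (boxes Z n))).
  by apply/fsubset_leq_card/fsubsetP => t; rewrite !inE => /andP[].
apply: (leq_trans (card_bigfcup_sum_le _ _)).
apply: (leq_trans (leq_sum _ (fun l _ => size_level Z n l))).
by rewrite (leq_trans (sum_pow8_le _))// leq_mul2l leq_pexp2l.
Qed.

Lemma level_leaves (Z : cloud R) l t :
  t \in level Z n l -> is_leaf Z n t -> t \in leaves Z n.
Proof.
move=> tl lt; rewrite !inE; apply/andP; split=> //.
apply/bigfcupP; exists l => //; rewrite mem_iota /= ltnS andbT.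
exact: level_sub_depth (nmax_gt0 P) tl.
Qed.

Lemma leaves_level (Z : cloud R) t : t \in leaves Z n ->
  is_leaf Z n t /\ exists l, t \in level Z n l.
Proof.
by rewrite !inE => /andP[/bigfcupP[l _ tl] lt]; split=> //; exists l.
Qed.

(** An inadmissible block can be a leaf of the block tree only because one of its components is a
    leaf. *)
Lemma nearfieldP b : b \in NF ->
  ((b.1 \in leaves X n) || (b.2 \in leaves Y n)) /\
  exists l, (b.1 \in level X n l) && (b.2 \in level Y n l).
Proof.
move=> /bigfcupP[l _ bN].
have /and3P[/blocks_level bl leaf nadm] :
    [&& b \in blocks eta2 P l, block_leaf eta2 P b & ~~ adm eta2 P b].
  by move: bN; rewrite !inE.
split; last by exists l.
have /andP[b1 b2] := bl.
move: leaf; rewrite /block_leaf (negbTE nadm) orbF => /orP[] h; apply/orP.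
  by left; exact: level_leaves b1 h.
by right; exact: level_leaves b2 h.
Qed.

(** All partners of [s] belong to the level of [s], so they are disjoint and share the points of the
    cloud. *)
Lemma near_indices_trg s : s \in leaves Y n ->
  (\sum_(b <- NF | b.2 == s) #|indices X b.1| <= npts X)%N.
Proof.
move=> /leaves_level[_ [l sl]]; rewrite -big_filter.
rewrite -(big_map fst xpredT (fun t => #|indices X t|)).
apply: (@sum_indices_le _ X n l).
  rewrite map_inj_in_uniq ?filter_uniq ?fset_uniq// => -[t s1] [t' s2].
  by rewrite !mem_filter /= => /andP[/eqP-> _] /andP[/eqP-> _] ->.
move=> _ /mapP[b + ->]; rewrite mem_filter => /andP[/eqP bs].
move=> /nearfieldP[_ [k /andP[b1 b2]]].
by rewrite bs in b2; rewrite (level_inj sl b2).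
Qed.

Lemma near_indices_src t : t \in leaves X n ->
  (\sum_(b <- NF | b.1 == t) #|indices Y b.2| <= npts Y)%N.
Proof.
move=> /leaves_level[_ [l tl]]; rewrite -big_filter.
rewrite -(big_map snd xpredT (fun s => #|indices Y s|)).
apply: (@sum_indices_le _ Y n l).
  rewrite map_inj_in_uniq ?filter_uniq ?fset_uniq// => -[t1 s] [t2 s'].
  by rewrite !mem_filter /= => /andP[/eqP-> _] /andP[/eqP-> _] ->.
move=> _ /mapP[b + ->]; rewrite mem_filter => /andP[/eqP bt].
move=> /nearfieldP[_ [k /andP[b1 b2]]].
by rewrite bt in b1; rewrite (level_inj tl b1).
Qed.

Lemma near_entries_le (c_m c_nf : R) (c_in : nat) :
  (#|` outlying_trg eta2 P c_m c_nf| <= c_in)%N ->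
  (#|` outlying_src eta2 P c_m c_nf| <= c_in)%N ->
  (\sum_(A <- step6 eta2 P) entries A <=
   2 * (n * (2 * 8 ^ pmax P * (Num.truncn c_nf * Num.truncn (c_m * n%:R)) +
             c_in * npoints P)))%N.
Proof.
move=> oT oS; rewrite /step6 big_map /entries /=.
have -> : forall x, (2 * x = x + x)%N by move=> x; rewrite mul2n addnn.
pose w b := (#|indices X b.1| * #|indices Y b.2|)%N.
(* Blocks are charged to a leaf component; those with two leaf components may be counted twice.
   [near_sum_le] then bounds either sum, with the outlying leaves as exceptional set. *)
apply: (@leq_trans (\sum_(b <- NF | b.1 \in leaves X n) w b +
                    \sum_(b <- NF | b.2 \in leaves Y n) w b)).
  rewrite [X in (_ <= X + _)%N]big_mkcond [X in (_ <= _ + X)%N]big_mkcond -big_split /=.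
  rewrite big_seq [leqRHS]big_seq; apply: leq_sum => b /nearfieldP[+ _].
  by case/orP => ->; rewrite ?leq_addr ?leq_addl.
(* The real bounds may be rounded down because they bound natural numbers, which also makes them
   nonnegative. *)
have count_nat (A : {fset box R * box R}) (q : pred (box R * box R)) (c : R) :
    (#|` [fset b in A | q b]%fset|)%:R <= c ->
    (size [seq b <- A | q b] <= Num.truncn c)%N.
  move=> Ac; have c0 : 0 <= c by apply: le_trans Ac.
  rewrite truncn_ge_nat// (le_trans _ Ac)// ler_nat.
  rewrite uniq_leq_size ?filter_uniq ?fset_uniq//.
  by move=> b; rewrite mem_filter !inE andbC.
have weight_nat k c : k%:R <= c -> (k <= Num.truncn c)%N.
  by move=> kc; rewrite truncn_ge_nat// (le_trans _ kc).
rewrite leq_add//.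
  rewrite /w; under eq_bigr do rewrite mulnC.
  apply: leq_trans (near_sum_le (O := outlying_trg eta2 P c_m c_nf)
    (c := Num.truncn c_nf) (c' := Num.truncn (c_m * n%:R)) (n := n) (N := npoints P)
    _ _ _ _) _.
  - exact: fset_uniq.
  - by move=> b _ /leaves_level[].
  - move=> t tL tO.
    have /andP[/count_nat tc /allP tm] : nonoutlying_trg eta2 P c_m c_nf t.
      by apply: contraNT tO; move: tL; rewrite !inE => -> ->.
    split=> // b bN bt.
    by apply: weight_nat; have := tm b bN; rewrite bt eqxx.
  - move=> t tO; have /near_indices_src/leq_trans h : t \in leaves X n.
      by move: tO; rewrite !inE => /andP[].
    exact: h (leq_maxr _ _).
  by rewrite leq_mul2l leq_add ?orbT ?leq_mul ?size_leaves ?leq_maxl.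
rewrite /w.
apply: leq_trans (near_sum_le (O := outlying_src eta2 P c_m c_nf)
    (c := Num.truncn c_nf) (c' := Num.truncn (c_m * n%:R)) (n := n) (N := npoints P)
    _ _ _ _) _.
- exact: fset_uniq.
- by move=> b _ /leaves_level[].
- move=> s sL sO.
  have /andP[/count_nat sc /allP sm] : nonoutlying_src eta2 P c_m c_nf s.
    by apply: contraNT sO; move: sL; rewrite !inE => -> ->.
  split=> // b bN bs.
  by apply: weight_nat; have := sm b bN; rewrite bs eqxx.
- move=> s sO; have /near_indices_trg/leq_trans h : s \in leaves Y n.
    by move: sO; rewrite !inE => /andP[].
  exact: h (leq_maxl _ _).
by rewrite leq_mul2l leq_add ?orbT ?leq_mul ?size_leaves ?leq_maxr.
Qed.

End Near.

(** * Complexity *)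

Section Total.

Variables (R : realType) (m : nat) (eta2 : R).
Hypothesis eta2_gt0 : 0 < eta2.

(** The three summands stand for steps 1, 2, 4 and 5, for step 3, and for step 6. *)
Lemma complexity_le (P : problem R) (c_m c_nf : R) (c_hf c_in : nat) :
  lhf P + 1 <= (pmax P + c_hf)%:Z ->
  (#|` outlying_trg eta2 P c_m c_nf| <= c_in)%N ->
  (#|` outlying_src eta2 P c_m c_nf| <= c_in)%N ->
  (complexity m eta2 P <=
   (2 * (nmax P * #|{: tidx m}|) + 2 * (8 * #|{: tidx m}| ^ 2)) *
     (12 * 4 ^ c_hf * 8 ^ pmax P) +
   #|{: tidx m}| ^ 2 * \sum_(l <- iota 0 (pmax P).+1) size (blocks eta2 P l) +
   2 * (nmax P * (2 * 8 ^ pmax P * (Num.truncn c_nf * Num.truncn (c_m * (nmax P)%:R)) +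
                  c_in * npoints P)))%N.
Proof.
move=> hp oT oS; set S := (\sum_(l <- _) _)%N.
have leS (q : nat) l : (q <= pmax P)%N -> l \in iota 0 q.+1 -> (l <= pmax P)%N.
  by rewrite mem_iota /= ltnS => qp lq; rewrite (leq_trans lq).
have leP (q : nat) l : (q <= pmax P)%N -> l \in iota 0 q -> (l <= pmax P)%N.
  by rewrite mem_iota /= => qp lq; rewrite ltnW ?(leq_trans lq).
have dT : (depth_trg P <= pmax P)%N by rewrite leq_maxl.
have dS : (depth_src P <= pmax P)%N by rewrite leq_maxr.
(* Transfers stop one level above the depth; the missing level is added to reuse the sum of
   [sum_dirs_le]. *)
have sub q (F : nat -> nat) : (\sum_(l <- iota 0 q) F l <= \sum_(l <- iota 0 q.+1) F l)%N.
  by rewrite -[in iota _ q.+1]addn1 iotaD big_cat leq_addr.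
pose d l := (6 * 4 ^ (pmax P + c_hf - l))%N.
have s1 := @interp_entries_le _ P m (src P) (kappa P) (dirs_src eta2 P) _ d
  (fun l s lr => size_dirs_src eta2 s hp (leS _ l dS lr)).
have s5 := @interp_entries_le _ P m (trg P) (kappa P) (dirs_trg eta2 P) _ d
  (fun l s lr => size_dirs_trg eta2 s hp (leS _ l dT lr)).
have rdS l : l \in rev (iota 0 (depth_src P)) -> (l <= pmax P)%N.
  by rewrite mem_rev; exact: leP.
have s2 := @transfer_entries_le _ P m (src P) (kappa P) (dirs_src eta2 P) _ d
  (fun l s lr => size_dirs_src eta2 s hp (rdS l lr)) (fun l => dir_at P l.+1).
have s4 := @transfer_entries_le _ P m (trg P) (kappa P) (dirs_trg eta2 P) _ d
  (fun l s lr => size_dirs_trg eta2 s hp (leP _ l dT lr)) (fun l => dir_at P l.+1).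
have s3 := @coupling_entries_le _ eta2 P m (iota 0 (pmax P).+1).
have s6 := near_entries_le oT oS.
have Dle q : (q <= pmax P)%N ->
    (\sum_(l <- iota 0 q.+1) 8 ^ l * d l <= 12 * 4 ^ c_hf * 8 ^ pmax P)%N.
  exact: sum_dirs_le.
have {}s1 : (\sum_(A <- step1 m eta2 P) entries A <= _)%N :=
  leq_trans s1 (leq_mul (leqnn _) (Dle _ dS)).
have {}s5 : (\sum_(A <- step5 m eta2 P) entries A <= _)%N :=
  leq_trans s5 (leq_mul (leqnn _) (Dle _ dT)).
rewrite big_rev in s2.
have {}s2 : (\sum_(A <- step2 m eta2 P) entries A <= _)%N :=
  leq_trans s2 (leq_mul (leqnn _) (leq_trans (sub _ _) (Dle _ dS))).
have {}s4 : (\sum_(A <- step4 m eta2 P) entries A <= _)%N :=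
  leq_trans s4 (leq_mul (leqnn _) (leq_trans (sub _ _) (Dle _ dT))).
have {}s3 : (\sum_(A <- step3 m eta2 P) entries A <= _)%N := s3.
have -> := sum_ringE _ _ : complexity m eta2 P = _.
(* Kept abstract, since unification would unfold the steps. *)
move: (step1 _ _ _) (step2 _ _ _) (step3 _ _ _) (step4 _ _ _) (step5 _ _ _)
  (step6 _ _) s1 s2 s3 s4 s5 s6 => t1 t2 t3 t4 t5 t6 s1 s2 s3 s4 s5 s6.
rewrite !big_cat /=.
apply: leq_trans (leq_add s1 (leq_add s2 (leq_add s3 (leq_add s4 (leq_add s5 s6))))) _.
by rewrite -/S; lia.
Qed.

(** Passing to level [l] divides the cube of kappa * q_0 by 8^l, while there are up to 8^l target
    boxes: the frequency term is the same on every level. *)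
Lemma size_blocks_le (P : problem R) (w : R) l : 0 <= w ->
  (forall i, q0 P <= w * side (root_box (src P)) i) ->
  (size (blocks eta2 P l))%:R <=
  (1 + 64 * (4 * (1 + 2 * w * (2 + 9 / eta2)) ^+ 3)) * (8 ^+ l + (kappa P * q0 P) ^+ 3).
Proof.
move=> w0 qw; set K := 4 * _; set x := (kappa P * q0 P) ^+ 3.
have x0 : 0 <= x by rewrite exprn_ge0// mulr_ge0 ?ltW ?kappa_gt0 ?q0_gt0.
have K0 : 0 <= K.
  rewrite mulr_ge0// exprn_ge0// addr_ge0// mulr_ge0 ?mulr_ge0//.
  by rewrite addr_ge0// divr_ge0// ltW.
(* The root level is a single block, paid for by the summand 1 of the constant. *)
case: l => [|l].
  rewrite /= cardfs1 expr0 -[leLHS]mulr1 ler_pM// ?lerDl//.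
  by rewrite mulr_ge0.
have lK t : t \in level (trg P) (nmax P) l ->
    (size [seq s <- level (src P) (nmax P) l | ~~ adm eta2 P (t, s)])%:R <=
    K * (1 + x / 8 ^+ l).
  move=> tl; apply: (le_trans (size_nonadm eta2_gt0 qw tl)); rewrite -/K.
  rewrite [(kappa P * _)%R]mulrA expr_div_n -/x -exprM mulnC exprM.
  by have -> : 2 ^+ 3 = 8 :> R by rewrite -natrX.
have e8 : 0 < 8 ^+ l :> R by rewrite exprn_gt0.
clearbody K.
apply: (@le_trans _ _ (64 * (8 ^+ l * (K * (1 + x / 8 ^+ l))))).
  apply: (@le_trans _ _ (64 * \sum_(t <- level (trg P) (nmax P) l)
      (size [seq s <- level (src P) (nmax P) l | ~~ adm eta2 P (t, s)])%:R)).
    by rewrite -natr_sum -natrM ler_nat size_blocksS.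
  rewrite ler_pM2l//.
  apply: (@le_trans _ _ ((size (level (trg P) (nmax P) l))%:R *
      (K * (1 + x / 8 ^+ l)))).
    rewrite -sum1_size natr_sum mulr_suml big_seq [leRHS]big_seq; apply: ler_sum => t tl.
    by rewrite mul1r lK.
  rewrite ler_wpM2r ?mulr_ge0 ?addr_ge0 ?divr_ge0 ?(ltW e8)//.
  by rewrite -natrX ler_nat size_level.
have -> : 64 * (8 ^+ l * (K * (1 + x / 8 ^+ l))) = 64 * K * (8 ^+ l + x).
  by field; rewrite gt_eqF.
apply: ler_pM => //; rewrite ?mulr_ge0 ?addr_ge0 ?(ltW e8)//; first by rewrite lerDr.
by rewrite lerD2r exprS ler_peMl ?(ltW e8)// ler1n.
Qed.

(** The powers of 8 form a geometric sum, but the level-independent frequency term is multiplied by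
    the number [pmax P] + 1 of levels. *)
Lemma sum_blocks_le (P : problem R) (w : R) : 0 <= w ->
  (forall i, q0 P <= w * side (root_box (src P)) i) ->
  (\sum_(l <- iota 0 (pmax P).+1) size (blocks eta2 P l))%:R <=
  (1 + 64 * (4 * (1 + 2 * w * (2 + 9 / eta2)) ^+ 3)) *
  (2 * 8 ^+ pmax P + ((pmax P)%:R + 1) * (kappa P * q0 P) ^+ 3).
Proof.
move=> w0 qw; set K := 1 + _.
have K0 : 0 <= K.
  rewrite addr_ge0// mulr_ge0// mulr_ge0// exprn_ge0// addr_ge0// mulr_ge0 ?mulr_ge0//.
  by rewrite addr_ge0// divr_ge0// ltW.
rewrite natr_sum; apply: (le_trans (ler_sum _ (fun l _ => size_blocks_le l w0 qw))).
rewrite -/K -mulr_sumr ler_wpM2l// big_split /= lerD//.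
  under eq_bigr do rewrite -natrX.
  by rewrite -natr_sum -natrX -natrM ler_nat sum_pow8_le.
by rewrite big_const_seq count_predT /= size_iota -iterS iter_addr_0 natr1 mulr_natl.
Qed.

(** The source diameter is at most the sum of its three sides, each at most [c_sh] times side
    [i]. *)
Lemma q0_le_side (P : problem R) (c_un c_sh : R) i : 0 <= c_un ->
  aspect_le c_sh (root_box (src P)) ->
  q0 P <= c_un * Num.min (q0_trg P) (q0_src P) ->
  q0 P <= c_un * (3 * c_sh) * side (root_box (src P)) i.
Proof.
move=> cu asp /le_trans; apply; rewrite -mulrA ler_wpM2l// ge_min; apply/orP; right.
apply: (le_trans (diam_le_sides (root_box_gt0 (src P)))).
rewrite -mulrA !big_ord_recr big_ord0 /= add0r.
have a := asp (widen_ord (leqnSn 2) (widen_ord (leqnSn 1) ord_max)) i.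
have b := asp (widen_ord (leqnSn 2) ord_max) i.
by have := asp ord_max i; lra.
Qed.

(** Collects everything into a constant chosen before [P]; the assumptions on depth and frequency
    are left for the final step. *)
Lemma complexity_bound (c_max c_un c_sh c_m c_nf : R) (c_hf c_in : nat) :
  0 <= c_max -> 0 <= c_un -> exists2 C : R, 0 <= C & forall P : problem R,
    aspect_le c_sh (root_box (src P)) ->
    (nmax P)%:R <= c_max * (m.+1 ^ 3)%:R ->
    q0 P <= c_un * Num.min (q0_trg P) (q0_src P) ->
    lhf P + 1 <= (pmax P + c_hf)%:Z ->
    (#|` outlying_trg eta2 P c_m c_nf| <= c_in)%N ->
    (#|` outlying_src eta2 P c_m c_nf| <= c_in)%N ->
    (complexity m eta2 P)%:R <=
    C * (8 ^+ pmax P + (npoints P)%:R + ((pmax P)%:R + 1) * (kappa P * q0 P) ^+ 3).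
Proof.
move=> cmax0 cun0.
have aux1 (a b y : R) : 0 <= a * y -> a * (2 * b + y) <= 2 * a * (b + y) by lra.
have aux2 (a b d s e f y : R) : s <= d * (e + y) -> 0 <= a * (f + y) ->
  0 <= b * (e + y) -> 0 <= d * f -> a * e + s + b * f <= (a + b + d) * (e + f + y) by lra.
have aux3 (a b c d e f s g h : nat) :
    ((2 * a + 2 * (8 * b)) * (12 * c * d) + b * s + 2 * (e * (2 * d * f + g * h)) =
    ((2 * a + 2 * (8 * b)) * (12 * c) + 2 * (e * (2 * f))) * d +
      b * s + 2 * (e * g) * h)%N.
  by ring.
pose n0 := Num.truncn (c_max * (m.+1 ^ 3)%:R).
pose M := #|{: tidx m}|.
pose q := (Num.truncn c_nf * Num.truncn (`|c_m| * n0%:R))%N.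
pose w := c_un * (3 * `|c_sh|).
pose K := 1 + 64 * (4 * (1 + 2 * w * (2 + 9 / eta2)) ^+ 3).
have w0 : 0 <= w by rewrite !mulr_ge0.
have K0 : 0 <= K.
  rewrite addr_ge0// mulr_ge0// mulr_ge0// exprn_ge0// addr_ge0// mulr_ge0 ?mulr_ge0//.
  by rewrite addr_ge0// divr_ge0// ltW.
(* [C1] gathers the coefficients of 8^p, and [C2] below those of the number of points. *)
pose C1 := ((2 * (n0 * M) + 2 * (8 * M ^ 2)) * (12 * 4 ^ c_hf) + 2 * (n0 * (2 * q)))%N.
pose C2 := (2 * (n0 * c_in))%N.
have MK0 : 0 <= (M ^ 2)%:R * (2 * K) by rewrite !mulr_ge0.
exists (C1%:R + C2%:R + (M ^ 2)%:R * (2 * K)); first by rewrite !addr_ge0.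
move=> P asp nP qP hP oT oS.
have nn0 : (nmax P <= n0)%N by rewrite truncn_ge_nat// mulr_ge0.
have qn : (Num.truncn c_nf * Num.truncn (c_m * (nmax P)%:R) <= q)%N.
  rewrite leq_mul2l le_truncn ?orbT// (le_trans (ler_norm _))// normrM normr_nat.
  by rewrite ler_wpM2l// ler_nat.
have qw i : q0 P <= w * side (root_box (src P)) i.
  apply: (q0_le_side _ cun0 _ qP) => j k; apply: (le_trans (asp j k)).
  by rewrite ler_wpM2r ?ler_norm// ltW ?root_box_gt0.
have := complexity_le hP oT oS; rewrite -/M; set S := (\sum_(l <- _) _)%N => cP.
have SK := sum_blocks_le w0 qw; rewrite -/S -/K in SK.
set x := (kappa P * q0 P) ^+ 3 in SK *; set p := pmax P in SK cP *.
have x0 : 0 <= x by rewrite exprn_ge0// mulr_ge0 ?ltW ?kappa_gt0 ?q0_gt0.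
have px0 : 0 <= (p%:R + 1) * x by rewrite mulr_ge0// addr_ge0.
have : (complexity m eta2 P <= C1 * 8 ^ p + M ^ 2 * S + C2 * npoints P)%N.
  apply: (leq_trans cP).
  have h1 : (nmax P * M <= n0 * M)%N by rewrite leq_mul2r nn0 orbT.
  have h2 := leq_mul (leqnn (2 * 8 ^ p)%N) qn.
  apply: (@leq_trans ((2 * (n0 * M) + 2 * (8 * M ^ 2)) * (12 * 4 ^ c_hf * 8 ^ p) +
    M ^ 2 * S + 2 * (n0 * (2 * 8 ^ p * q + c_in * npoints P)))).
    by rewrite !leq_add ?leq_mul ?leq_add// ?leq_mul.
  by rewrite aux3.
clearbody C1 C2 K.
rewrite -(ler_nat R) => /le_trans; apply.
rewrite !natrD (natrM R C1) (natrM R (M ^ 2)) (natrM R C2) [(8 ^ p)%:R]natrX.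
have h3 : (M ^ 2)%:R * S%:R <= (M ^ 2)%:R * (2 * K) * (8 ^+ p + (p%:R + 1) * x).
  rewrite -[leRHS]mulrA ler_wpM2l// (le_trans SK)//.
  by rewrite aux1// mulr_ge0.
have a0 : 0 <= 8 ^+ p :> R by rewrite exprn_ge0.
by apply: aux2 h3 _ _ _; rewrite mulr_ge0// addr_ge0.
Qed.

End Total.

(** Each [C] is chosen before [P], so the bounds are uniform over all problems. The aspect ratio
    [c_sh] makes the sides of the root boxes comparable to their diameters, and N >= 2 keeps [ln N]
    away from 0. *)
Theorem theorem5 (R : realType) (m : nat)
    (eta2 c_max c_un c_ad c_sh c_m c_nf : R) (c_hf c_in : nat)
    (eta2_gt0 : 0 < eta2) (c_max_ge0 : 0 <= c_max) (c_un_ge0 : 0 <= c_un)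
    (c_ad_ge0 : 0 <= c_ad) (c_in_gt0 : (0 < c_in)%N) :
  (forall c_geo : R, 0 <= c_geo ->
   exists C : R, forall P : problem R,
     let N : R := (npoints P)%:R in
     (2 <= npoints P)%N ->
     aspect_le c_sh (root_box (trg P)) ->
     aspect_le c_sh (root_box (src P)) ->
     (nmax P)%:R <= c_max * (m.+1 ^ 3)%:R ->
     q0 P <= c_un * Num.min (q0_trg P) (q0_src P) ->
     (pmax P)%:R <= ln N / ln 8 + c_ad ->
     kappa P * q0 P <= c_geo * (N `^ (3^-1)) ->
     lhf P + 1 <= (pmax P + c_hf)%:Z ->
     (#|` outlying_trg eta2 P c_m c_nf| <= c_in)%N ->
     (#|` outlying_src eta2 P c_m c_nf| <= c_in)%N ->
     (complexity m eta2 P)%:R <= C * (N * ln N)) /\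
  (forall c : R, 0 <= c ->
   exists C : R, forall P : problem R,
     let N : R := (npoints P)%:R in
     (2 <= npoints P)%N ->
     aspect_le c_sh (root_box (trg P)) ->
     aspect_le c_sh (root_box (src P)) ->
     (nmax P)%:R <= c_max * (m.+1 ^ 3)%:R ->
     q0 P <= c_un * Num.min (q0_trg P) (q0_src P) ->
     (pmax P)%:R <= ln N / ln 8 + c_ad ->
     kappa P * q0 P <= c * ((N / ln N) `^ (3^-1)) ->
     lhf P + 1 <= (pmax P + c_hf)%:Z ->
     (#|` outlying_trg eta2 P c_m c_nf| <= c_in)%N ->
     (#|` outlying_src eta2 P c_m c_nf| <= c_in)%N ->
     (complexity m eta2 P)%:R <= C * N).
Proof.
have [C0 C00 bound] :=
  complexity_bound m eta2_gt0 c_sh c_m c_nf c_hf c_in c_max_ge0 c_un_ge0.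
have l2 : 0 < ln 2 :> R by rewrite ln_gt0// ltr1n.
have l8 : 0 < ln 8 :> R by rewrite ln_gt0// ltr1n.
pose E := expR (c_ad * ln 8).
(* Chosen so that p + 1 <= [F * ln N]: the constant [c_ad + 1] is absorbed by means of ln 2 <= ln
   N. *)
pose F := (ln 8)^-1 + (c_ad + 1) / ln 2.
have E0 : 0 <= E by rewrite expR_ge0.
have depth_le (N : R) p : 2 <= N -> p <= ln N / ln 8 + c_ad -> p + 1 <= F * ln N.
  move=> N2 pN; have lN : ln 2 <= ln N by rewrite ler_ln ?posrE// (lt_le_trans _ N2).
  have : (c_ad + 1) * 1 <= (c_ad + 1) * (ln N / ln 2).
    by rewrite ler_wpM2l ?addr_ge0// ler_pdivlMr// mul1r.
  have -> : F * ln N = ln N / ln 8 + (c_ad + 1) * (ln N / ln 2).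
    by rewrite /F; field; rewrite !gt_eqF.
  lra.
split=> c c0.
  (* The terms 8^p + N are at most ([E] + 1) N, and one factor [ln N / ln 2] is spent on them; the
     frequency term gives [F * c ^+ 3]. *)
  exists (C0 * ((E + 1) / ln 2 + F * c ^+ 3)) => P N N2 _ asp nP qP pP kP hP oT oS.
  have {}N2 : 2 <= N by rewrite ler_nat.
  have N0 : 0 < N by exact: lt_le_trans N2.
  have lN : ln 2 <= ln N by rewrite ler_ln ?posrE.
  apply: (le_trans (bound P asp nP qP hP oT oS)); rewrite -mulrA ler_wpM2l//.
  have a := pow8_depth_le N0 pP; have b := depth_le _ _ N2 pP.
  have k3 : (kappa P * q0 P) ^+ 3 <= c ^+ 3 * N.
    rewrite -[N in leRHS](powR_cbrtK (ltW N0)) -exprMn lerXn2r// nnegrE.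
      by rewrite mulr_ge0// ltW ?kappa_gt0 ?q0_gt0.
    by rewrite mulr_ge0 ?powR_ge0.
  have k0 : 0 <= (kappa P * q0 P) ^+ 3.
    by rewrite exprn_ge0// mulr_ge0 ?ltW ?kappa_gt0 ?q0_gt0.
  have : ((pmax P)%:R + 1) * (kappa P * q0 P) ^+ 3 <= F * ln N * (c ^+ 3 * N).
    by rewrite ler_pM// addr_ge0.
  have : (E + 1) * N * ln 2 <= (E + 1) * N * ln N.
    by rewrite ler_wpM2l// mulr_ge0 ?addr_ge0// ltW.
  rewrite -ler_pdivlMr// => h1 h2.
  have -> : ((E + 1) / ln 2 + F * c ^+ 3) * (N * ln N) =
    (E + 1) * N * ln N / ln 2 + F * ln N * (c ^+ 3 * N) by field; rewrite gt_eqF.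
  by rewrite lerD// (le_trans _ h1)// mulrDl mul1r lerD2r mulrC.
(* Here the logarithm from the number of levels cancels the one in N / ln N. *)
exists (C0 * (E + 1 + F * c ^+ 3)) => P N N2 _ asp nP qP pP kP hP oT oS.
have {}N2 : 2 <= N by rewrite ler_nat.
have N0 : 0 < N by exact: lt_le_trans N2.
have lN : 0 < ln N by rewrite ln_gt0// (lt_le_trans _ N2)// ltr1n.
apply: (le_trans (bound P asp nP qP hP oT oS)); rewrite -mulrA ler_wpM2l//.
have a := pow8_depth_le N0 pP; have b := depth_le _ _ N2 pP.
have k3 : (kappa P * q0 P) ^+ 3 <= c ^+ 3 * (N / ln N).
  rewrite -[N / ln N in leRHS]powR_cbrtK ?(divr_ge0 (ltW N0) (ltW lN))//.
  rewrite -exprMn lerXn2r// nnegrE.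
    by rewrite mulr_ge0// ltW ?kappa_gt0 ?q0_gt0.
  by rewrite mulr_ge0 ?powR_ge0.
have k0 : 0 <= (kappa P * q0 P) ^+ 3.
  by rewrite exprn_ge0// mulr_ge0 ?ltW ?kappa_gt0 ?q0_gt0.
have : ((pmax P)%:R + 1) * (kappa P * q0 P) ^+ 3 <= F * ln N * (c ^+ 3 * (N / ln N)).
  by rewrite ler_pM// addr_ge0.
have -> : F * ln N * (c ^+ 3 * (N / ln N)) = F * c ^+ 3 * N by field; rewrite gt_eqF.
by move=> h; rewrite [leRHS]mulrDl lerD// [leRHS]mulrDl mul1r lerD2r mulrC.
Qed.
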